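(* Let $\mathcal V$ be a finite set with $|\mathcal V|\ge 2$, let $\epsilon\ge0$, and let $\mathbf w=\{w_j\}_{j\in\mathcal V}$ be a family of vectors in $\mathbb R^d$. If a word $i\in\mathcal V$ is $\epsilon$-recognizable (with respect to $\mathbf w$), then $$\min_{j\neq i}\|w_j-w_i\|>\epsilon .$$
   Context: $\|\cdot\|$ denotes the Euclidean norm. Elements of $\mathcal V$ are called words and $w_j$ is the embedding vector of word $j$. A word $i\in\mathcal V$ is called $\epsilon$-recognizable if there exists a vector $h\in\mathbb R^d$ such that $$\min_{\|\delta_i\|\le\epsilon}(w_i+\delta_i)^\top h = w_i^\top h-\epsilon\|h\| > w_j^\top h\qquad\text{for all } j\in\mathcal V,\ j\neq i .$$ *)

(* Defs.v *)
From HB Require Import structures.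
From mathcomp Require Import all_boot all_order all_algebra.
From mathcomp Require Import all_classical all_reals.

Set Implicit Arguments.
Unset Strict Implicit.
Unset Printing Implicit Defensive.

Import Order.TTheory GRing.Theory Num.Theory.
Local Open Scope classical_set_scope.
Local Open Scope ring_scope.

Definition dotv (R : realType) (d : nat) (u v : 'cV[R]_d) : R :=
  (u^T *m v) 0 0.

(* The Euclidean norm; MathComp-Analysis equips matrices with the sup norm. *)
Definition enorm (R : realType) (d : nat) (v : 'cV[R]_d) : R :=
  Num.sqrt (\sum_(k < d) v k 0 ^+ 2).

(* m = min A, which entails that the minimum is attained. *)
Definition is_min (R : realType) (A : set R) (m : R) : Prop :=
  A m /\ lbound A m.

(* The first conjunct says that the minimum equals its closed form; for
   0 <= eps it holds for every h, by Cauchy-Schwarz. *)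
Definition recognizable (R : realType) (d : nat) (V : finType)
    (eps : R) (w : V -> 'cV[R]_d) (i : V) : Prop :=
  exists h : 'cV[R]_d,
    is_min [set dotv (w i + delta) h | delta in [set delta | enorm delta <= eps]]
           (dotv (w i) h - eps * enorm h)
    /\ forall j : V, j != i -> dotv (w i) h - eps * enorm h > dotv (w j) h.

(* Main.v *)
(** If some [w j] with [j != i] were within [eps] of [w i], then
    [delta := w j - w i] would be an admissible perturbation turning [w i] into
    [w j], so the minimum over perturbations could not exceed [dotv (w j) h]. *)

Require Import Defs.
From HB Require Import structures.
From mathcomp Require Import all_boot all_order all_algebra.
From mathcomp Require Import all_classical all_reals.

Set Implicit Arguments.
Unset Strict Implicit.
Unset Printing Implicit Defensive.

Import Order.TTheory GRing.Theory Num.Theory.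
Local Open Scope classical_set_scope.
Local Open Scope ring_scope.

Theorem theorem3p3 (R : realType) (d : nat) (V : finType) (hV : (2 <= #|V|)%N)
    (eps : R) (heps : 0 <= eps) (w : V -> 'cV[R]_d) (i : V)
    (hi : recognizable eps w i) :
  exists m : R,
    is_min [set enorm (w j - w i) | j in [set j : V | j != i]] m /\ m > eps.
Proof.
(* [hV] supplies a competitor of [i], the starting index that [arg_minP] requires. *)
have [j0 j0i] : exists j0, j0 != i.
  have : (0 < #|predC1 i|)%N by rewrite cardC1 -ltnS prednK // ltnW.
  by case/card_gt0P => j0; rewrite inE => ?; exists j0.
(* Minimizing over the finite index set yields a nearest competitor [j]; its distance is the
   attained minimum [m], so only this [j] has to be compared with [eps]. *)
case: (@arg_minP _ _ _ j0 (predC1 i) (fun j => enorm (w j - w i)) j0i) =>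
  j ji jmin.
exists (enorm (w j - w i)); split.
  by split; [exists j | move=> _ [k /= ki <-]; exact: jmin].
have [h [[_ min_lb] hlt]] := hi.
rewrite ltNge; apply/negP => close.
(* The strict margin at [j] is refuted by the reverse inequality, an instance of [min_lb]; [close]
   makes the perturbation admissible. *)
have := hlt j ji; rewrite ltNge => /negP; apply.
by apply: min_lb; exists (w j - w i) => //; rewrite addrC subrK.
Qed.
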